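(* Let $X$ be a connected graph (multiple edges and loops allowed) in which small cycles are dense, and suppose there is $M<\infty$ such that $2\le\deg(x)\le M$ for all $x\in X$. Let $q^{(n)}(x,y)$ be the $n$-step probabilities of non-backtracking random walk on $X$ and $\rho(Q)=\limsup_{n\to\infty}q^{(n)}(x,y)^{1/n}$. Then $X$ is amenable if and only if $\rho(Q)=1$.
   Context: $X$ denotes both the graph and its vertex set. For vertices $x\neq y$, $e(x,y)$ is the number of edges between $x$ and $y$; $e(x,x)$ is twice the number of loops at $x$; $\deg(x)=\sum_y e(x,y)$. To each unoriented edge (including each loop) one associates two oppositely oriented edges $e,\check e$ with $\check{\check e}=e$, $e\ne\check e$; $E=E(X)$ is the set of all oriented edges. $e^-$ and $e^+$ are the initial and terminal vertices of $e$, so $(\check e)^-=e^+$ and $(\check e)^+=e^-$. Write $e\to f$ if $f^-=e^+$ and $f\neq\check e$. Non-backtracking random walk (NBRW): starting at a vertex $x$, the walker chooses uniformly one of the $\deg(x)$ oriented edges with initial vertex $x$ and moves to its terminal vertex; thereafter, having just traversed $e$, he chooses uniformly among the $\deg(e^+)-1$ oriented edges $f$ with $e\to f$ and moves to $f^+$. $q^{(n)}(x,y)$ is the probability that the walker starting at $x$ is at $y$ at the $n$-th step. Equivalently, with $Q_E=(q_E(e,f))_{e,f\in E}$, $q_E(e,f)=1/(\deg(e^+)-1)$ if $e\to f$ and $0$ otherwise, and $q_E^{(n)}(e,f)$ the entries of $Q_E^n$, one has $q^{(n)}(x,y)=\frac1{\deg(x)}\sum_{e^+=x,\,f^+=y}q_E^{(n)}(e,f)$.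 When small cycles are dense in $X$, $\rho(Q)=\limsup_n q^{(n)}(x,y)^{1/n}$ is independent of $x,y\in X$. A cycle of length $n\ge1$ in $X$ is a sequence $e_0,\dots,e_{n-1}$, $e_n=e_0$, of oriented edges, $e_0,\dots,e_{n-1}$ having pairwise distinct initial vertices, with $e_{k-1}\to e_k$ for $k=1,\dots,n$ (so a loop is a cycle of length $1$ and a double edge gives a cycle of length $2$). $d(x,y)$ is the graph distance and the ball $B(x,R)$ is the subgraph of $X$ induced by $\{y\in X: d(y,x)\le R\}$. Small cycles are dense in $X$ if there is $R>0$ such that every ball $B(x,R)$, $x\in X$, contains a cycle. The isoperimetric constant is $\iota(X)=\inf\{\mathrm{Area}(F)/\mathrm{Vol}(F): F\subset X \text{ finite, nonempty}\}$, where $\mathrm{Vol}(F)=\sum_{x\in F}\deg(x)$ and $\mathrm{Area}(F)$ is the number of (unoriented) edges with one endpoint in $F$ and the other in $X\setminus F$. $X$ is amenable if $\iota(X)=0$ (in particular finite graphs are amenable). *)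

(* Defs.v *)
From HB Require Import structures.
From mathcomp Require Import all_boot all_order all_algebra finmap.
From mathcomp Require Import all_classical all_reals all_analysis.

Set Implicit Arguments.
Unset Strict Implicit.
Unset Printing Implicit Defensive.

Import Order.TTheory GRing.Theory Num.Theory.

Local Open Scope classical_set_scope.
Local Open Scope fset_scope.
Local Open Scope ring_scope.

(* A locally finite graph with multiple edges and loops, given by its vertices
   and its oriented edges.  An unoriented edge, possibly a loop, is a pair
   {e, erev e}; since erev has no fixed point, a loop at x gives two oriented
   edges from x to x.  [out x] lists the finitely many oriented edges with
   initial vertex x; it is determined by [src] through [mem_out]. *)
Record graph := Graph {
  vertex :> choiceType;
  edge : choiceType;
  src : edge -> vertex;
  tgt : edge -> vertex;
  erev : edge -> edge;
  out : vertex -> {fset edge};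
  erevK : involutive erev;
  erev_neq : forall e, erev e != e;
  src_erev : forall e, src (erev e) = tgt e;
  mem_out : forall x e, (e \in out x) = (src e == x) }.

Arguments src {g}.
Arguments tgt {g}.
Arguments erev {g}.
Arguments out {g}.

Section Graph.
Variable X : graph.
Implicit Types (x y : X) (e f g : edge X).

(* Equals \sum_y e(x, y), where e(x, x) counts every loop at x twice. *)
Definition deg x : nat := #|` out x|.

Definition into y : {fset edge X} := [fset erev e | e in out y].

(* The relation e -> f *)
Definition nb : rel (edge X) :=
  fun e f => (src f == tgt e) && (f != erev e).

Fixpoint walk x (p : seq (edge X)) y : bool :=
  if p is e :: p' then (src e == x) && walk (tgt e) p' y else x == y.

Definition graph_connected : Prop := forall x y, exists p, walk x p y.

Definition has_walk x y (n : nat) : Prop :=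
  exists2 p, walk x p y & size p = n.

(* The least length of a walk from x to y; 0 (unused) if there is none. *)
Definition dist x y : nat :=
  xget 0%N [set n | has_walk x y n /\ forall m, has_walk x y m -> (n <= m)%N].

Definition gball x (r : nat) : set X := [set y | (dist y x <= r)%N].

(* [cycle nb c] is the condition e_(k-1) -> e_k around the closed sequence c,
   including from its last edge to its first one. *)
Definition is_cycle (c : seq (edge X)) : bool :=
  [&& c != [::], cycle nb c & uniq (map src c)].

(* As c is closed, the initial vertices of its edges are all its vertices. *)
Definition contains_cycle (A : set X) : Prop :=
  exists2 c, is_cycle c & forall e, e \in c -> A (src e).

Definition small_cycles_dense : Prop :=
  exists2 r : nat, (0 < r)%N & forall x, contains_cycle (gball x r).

Definition Vol (F : {fset X}) : nat := (\sum_(x <- F) deg x)%N.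

(* An unoriented edge between F and its complement has exactly one orientation
   with initial vertex in F. *)
Definition Area (F : {fset X}) : nat :=
  (\sum_(x <- F) #|` [fset e in out x | tgt e \notin F]|)%N.

Section Real.
Variable R : realType.

Definition iota_const : R :=
  inf [set (Area F)%:R / (Vol F)%:R | F in [set F : {fset X} | F != fset0]].

Definition amenable : Prop := iota_const = 0.

Definition QE e f : R := if nb e f then ((deg (tgt e)).-1)%:R^-1 else 0.

(* The entries of the powers of QE; QE e g = 0 unless g \in out (tgt e). *)
Fixpoint QEn (n : nat) e f : R :=
  if n is n'.+1 then \sum_(g <- out (tgt e)) QE e g * QEn n' g f
  else (e == f)%:R.

(* q^(n)(x, y): the first edge is uniform among those starting at x, and the
   following ones are chosen according to QE. *)
Definition nbrw (n : nat) x y : R :=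
  if n is n'.+1 then
    \sum_(e <- out x) (deg x)%:R^-1 * \sum_(f <- into y) QEn n' e f
  else (x == y)%:R.

(* The value at n = 0 is irrelevant for the limit superior. *)
Definition rho x y : \bar R :=
  limn_esup (fun n => (nbrw n x y `^ n%:R^-1)%:E).

End Real.
End Graph.

Arguments amenable X R : clear implicits.

Section Checks.
Variables (X : graph) (R : realType).
Implicit Types (x y : X) (e f g : edge X).

Lemma tgt_erev e : tgt (erev e) = src e.
Proof. by rewrite -src_erev erevK. Qed.

Lemma mem_into y f : (f \in into y) = (tgt f == y).
Proof.
apply/imfsetP/eqP => [[e /= + ->]|<-].
  by rewrite mem_out tgt_erev => /eqP.
by exists (erev f); rewrite ?erevK //= mem_out src_erev.
Qed.

Lemma sum_into (h : edge X -> R) x :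
  \sum_(e <- into x) h e = \sum_(e <- out x) h (erev e).
Proof.
by rewrite big_imfset //= => e f _ _ /(can_inj (@erevK X)).
Qed.

Lemma nbrwE n x y : (1 < deg x)%N ->
  nbrw R n x y =
  (deg x)%:R^-1 * \sum_(e <- into x) \sum_(f <- into y) QEn R n e f.
Proof.
move=> dx; have dx0 : (deg x)%:R != 0 :> R by rewrite pnatr_eq0 -lt0n ltnW.
case: n => [|n] /=.
  have -> : \sum_(e <- into x) \sum_(f <- into y) (e == f)%:R =
            \sum_(e <- into x) (x == y)%:R :> R.
    rewrite big_seq [RHS]big_seq; apply: eq_bigr => e.
    rewrite mem_into => /eqP ex.
    have [xy|xy] := eqVneq x y.
      have ey : e \in into y by rewrite mem_into ex xy.
      rewrite (big_fsetD1 e ey) /= eqxx big1_seq ?addr0 // => f /=.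
      by rewrite !inE => /andP[/negPf + _]; rewrite eq_sym => ->.
    rewrite big1_seq // => f /= ; rewrite mem_into => /eqP fy.
    by case: eqP => // ef; rewrite -ex ef fy eqxx in xy.
  rewrite sum_into big_const_seq count_predT iter_addr_0.
  by rewrite -[_ *+ size _]mulr_natl mulrA mulVf // mul1r.
rewrite -mulr_sumr; congr (_ * _).
rewrite sum_into.
have E e : e \in out x -> \sum_(f <- into y) \sum_(g <- out (tgt (erev e)))
    QE R (erev e) g * QEn R n g f =
    \sum_(g <- out x | g != e) (deg x).-1%:R^-1 *
    \sum_(f <- into y) QEn R n g f.
  rewrite mem_out => /eqP ex; rewrite exchange_big /= tgt_erev ex.
  rewrite big_seq [in RHS]big_seq_cond [RHS]big_mkcondr /=.
  apply: eq_bigr => g; rewrite mem_out => /eqP gx.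
  rewrite -mulr_sumr /QE /nb tgt_erev erevK ex gx eqxx /=.
  by case: eqP => //=; rewrite mul0r.
rewrite [RHS]big_seq (eq_bigr _ E) -big_seq.
under [RHS]eq_bigr => e _ do rewrite big_mkcond.
rewrite [RHS]exchange_big /= big_seq [RHS]big_seq; apply: eq_bigr => g gx.
rewrite (big_fsetD1 g gx) /= eqxx add0r.
set c := _ * _; transitivity (\sum_(e <- out x `\ g) c); last first.
  by apply: eq_big_seq => e; rewrite !inE eq_sym => /andP[-> _].
rewrite big_const_seq count_predT iter_addr_0.
have -> : size (out x `\ g) = (deg x).-1.
  by rewrite /deg (cardfsD1 g (out x)) gx.
rewrite /c -[RHS]mulr_natl mulrA mulfV ?mul1r // pnatr_eq0.
by case: (deg x) dx => [|[]].
Qed.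

Lemma distP x y : graph_connected X ->
  has_walk x y (dist x y) /\ forall m, has_walk x y m -> (dist x y <= m)%N.
Proof.
move=> /(_ x y)[p xpy].
suff [n Pn] : exists n, [set n | has_walk x y n /\
    forall m, has_walk x y m -> (n <= m)%N] n by exact: (xgetI _ Pn).
have ex : exists n, `[< has_walk x y n >].
  by exists (size p); apply/asboolP; exists p.
case: (ex_minnP ex) => n /asboolP xyn min; exists n; split => // m xym.
by apply: min; apply/asboolP.
Qed.

End Checks.

(* Main.v *)
Require Import Defs.
From mathcomp Require Import all_boot all_order all_algebra finmap.
From mathcomp Require Import all_classical all_reals all_analysis.
From mathcomp Require Import zify ring lra.

(** Let Q be the transition matrix of the walk on oriented edges and J the
    reversal of edges.  Everything rests on two facts: Q is doubly stochastic
    ([QE_row], [QE_col]), and J Q J is the transpose of Q ([QE_erev]), so that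
    each matrix J Q^n is symmetric although Q is not.

    Nonamenable graphs.  For v with finite support,
      2 (|v|^2 - <v, Q v>) >= sum of Q(e, f) (v(e) - v(f))^2,
    and the right-hand side is at least a constant times |v|^2: this is a
    Cheeger inequality, obtained from the isoperimetric inequality on vertices
    ([isoperimetric_functional]) applied to the maximum of v^2 over the edges
    leaving a vertex ([sum_sqr_le_grad]).  Hence <v, Q v> <= (1 - k) |v|^2 for
    some k > 0 ([QE_form_le]).  With z = 1 + k this makes I - z Q coercive,
    which bounds the partial sums of the Green function of z Q in l^2
    uniformly, so that Q^n(e, f) = O(z^-n) ([QEn_decay]) and rho(Q) < 1.

    Amenable graphs.  Suppose that rho(Q) < 1.  If some degree exceeds 2, the
    density of small cycles provides a K such that every oriented edge leads to
    its own reverse in at most K non-backtracking steps ([uniform_reversal]).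
    For an edge f0 and some z > 1 the function G(e) = sum_l z^l Q^l(e, f0) is
    then finite and positive, and passing from e to J e costs at most a
    constant C which depends on K only: J Q^n G <= C z^-n G.  Since J Q^n is
    symmetric, Schur's test ([schur_test]) gives <u, J Q^n u> <= C z^-n |u|^2,
    and n can be chosen so that C z^-n < 1/2.  But if F is a finite set of
    vertices with small boundary and u the indicator of the set of edges that
    leave F, then <u, J Q^n u> is close to |u|^2 ([outs_mass]), a
    contradiction ([rho_amenable]).

    If all degrees are 2, then the graph is a single cycle, and the walk
    runs round it: at infinitely many times it is at y with probability at
    least 1/2 ([rho_regular2]). *)

Set Implicit Arguments.
Unset Strict Implicit.
Unset Printing Implicit Defensive.

(** * Non-backtracking paths and reversal *)

Section Reachability.
Variable X : graph.
Implicit Types (x y z w : X) (e f g h : edge X) (p c : seq (edge X)).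

Definition reaches n e f :=
  exists p, [/\ path (@nb X) e p, last e p = f & (size p <= n)%N].

Lemma nbP e f : reflect (src f = tgt e /\ f <> erev e) (nb e f).
Proof. by apply: (iffP andP) => -[? ?]; split; apply/eqP. Qed.

Lemma erev_inj : injective (@erev X).
Proof. exact: can_inj (@erevK X). Qed.

Lemma nb_erev e f : nb (erev f) (erev e) = nb e f.
Proof.
rewrite /nb src_erev tgt_erev (inj_eq erev_inj) eq_sym.
by rewrite -(inv_eq (@erevK X)) [f == _]eq_sym.
Qed.

Lemma path_nb_rev e p : path (@nb X) e p ->
  exists p', [/\ path (@nb X) (erev (last e p)) p',
    last (erev (last e p)) p' = erev e & size p' = size p].
Proof.
elim: p e => [|f p IHp] e /=; first by exists [::].
case/andP=> ef /IHp [p' [pp' lp' sp']]; exists (rcons p' (erev e)).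
by rewrite rcons_path last_rcons size_rcons sp' pp' lp' nb_erev.
Qed.

Lemma reaches_refl n e : reaches n e e.
Proof. by exists [::]. Qed.

Lemma reaches_leq m n e f : (m <= n)%N -> reaches m e f -> reaches n e f.
Proof. by move=> mn [p [? ? pm]]; exists p; split=> //; apply: leq_trans mn. Qed.

Lemma reaches_trans m n e f g :
  reaches m e f -> reaches n f g -> reaches (m + n) e g.
Proof.
move=> [p [pp <- sp]] [q [pq <- sq]]; exists (p ++ q).
by rewrite cat_path pp pq last_cat size_cat leq_add.
Qed.

Lemma reaches1 e f : nb e f -> reaches 1 e f.
Proof. by move=> ef; exists [:: f]; rewrite /= ef. Qed.

Lemma reachesS n e f g : reaches n e f -> nb f g -> reaches n.+1 e g.
Proof. by move=> ef /reaches1 fg; rewrite -addn1; apply: reaches_trans fg. Qed.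

Lemma reaches_erev n e f : reaches n e f -> reaches n (erev f) (erev e).
Proof. by move=> [p [/path_nb_rev [q [? ? sq]] <- sp]]; exists q; rewrite sq. Qed.

Lemma cycle_prev c e : cycle (@nb X) c -> e \in c -> nb (prev c e) e.
Proof. exact: prev_cycle. Qed.

Lemma reaches_cycle c e f : cycle (@nb X) c -> e \in c -> f \in c ->
  exists n, reaches n e f.
Proof.
move=> cc ec fc; have [i c' ci] := rot_to ec.
have : cycle (@nb X) (e :: c') by rewrite -ci rot_cycle.
have : f \in e :: c' by rewrite -ci mem_rot.
rewrite inE => /orP[/eqP -> _|fc' /= ecc]; first by exists 0; apply: reaches_refl.
case/splitPr: fc' ecc => p1 p2; rewrite rcons_cat cat_path /= => /and3P[pp1 lf _].
by exists (size p1).+1; exists (rcons p1 f); rewrite rcons_path pp1 lf last_rcons size_rcons.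
Qed.

Lemma cycle_propagate c h (P : edge X -> Prop) : uniq c -> h \in c -> P h ->
  (forall f, f \in c -> P f -> P (next c f)) -> forall f, f \in c -> P f.
Proof.
move=> uc hc Ph step f fc; have [i c' ci] := rot_to hc.
have : fcycle (next c) (h :: c') by rewrite -ci rot_cycle; apply: cycle_next.
rewrite /= rcons_path => /andP[+ _].
have : f \in h :: c' by rewrite -ci mem_rot.
elim: c' h hc Ph {ci} => [|g c' IHc] h hc Ph; first by rewrite inE => /eqP ->.
rewrite inE /= => /orP[/eqP -> //|fc'] /andP[/eqP hg pc'].
apply: (IHc g) => //; rewrite -hg; first by rewrite mem_next.
exact: step.
Qed.

Lemma cycle_nb_rev c : cycle (@nb X) c -> cycle (@nb X) (rev (map erev c)).
Proof.
rewrite rev_cycle cycle_map; apply: sub_cycle => e f /=.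
by rewrite nb_erev.
Qed.

Section MinDeg2.
Hypothesis deg2 : forall x, (2 <= deg x)%N.

(** The edge e has one successor fewer than the degree of its end, so some
    successor avoids any smaller set A. *)
Lemma nb_fresh e (A : {fset edge X}) : (#|` A| < (deg (tgt e)).-1)%N ->
  exists2 f, nb e f & f \notin A.
Proof.
move=> Ae; suff : ~~ (out (tgt e) `<=` (erev e |` A))%fset.
  case/fsubsetPn => f; rewrite mem_out !inE negb_or => /eqP sf /andP[/eqP fe fA].
  by exists f => //; apply/nbP.
apply/negP => /fsubset_leq_card; rewrite cardfsU1 -/(deg _) => le.
by have := leq_trans le (leq_add (leq_b1 _) (leqnn _)); lia.
Qed.

Lemma nb_extend e : exists f, nb e f.
Proof.
have [|f ef _] := @nb_fresh e fset0; last by exists f.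
by rewrite cardfs0; have := deg2 (tgt e); lia.
Qed.

Lemma path_nb_extend n e : exists2 p, path (@nb X) e p & size p = n.
Proof.
elim: n e => [|n IHn] e; first by exists [::].
have [f ef] := nb_extend e; have [p pp sp] := IHn f.
by exists (f :: p); rewrite /= ?ef ?sp.
Qed.

(** A step of the walk p either extends the non-backtracking path or, when it
    runs back along the last edge, shortens it by one; since p is no longer
    than q, the path never shrinks below e itself. *)
Lemma walk_from_path z p w m e q : walk z p w ->
  (size p <= m)%N -> path (@nb X) e q -> size q = m -> tgt (last e q) = w ->
  exists q', [/\ path (@nb X) e q', tgt (last e q') = z,
    (m - size p <= size q')%N & (size q' <= m + size p)%N].
Proof.
elim: p z => [|h p IHp] z /=.
  move=> /eqP -> _ pq sq lq; exists q; rewrite sq; split=> //; lia.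
case/andP=> /eqP sh wp sp pq sq lq.
have [q' [pq' lq' lo hi]] := IHp _ wp (ltnW sp) pq sq lq.
have [hl|/eqP hl] := eqVneq h (last e q').
  case/lastP: q' => [|q' g] in pq' lq' lo hi hl *.
    by have {}lo : (m - size p <= 0)%N := lo; lia.
  move: pq' lo hi; rewrite last_rcons rcons_path size_rcons in hl * => /andP[pq' /nbP[sg _]] lo hi.
  by exists q'; split=> //; first (by rewrite -sg -hl); lia.
exists (rcons q' (erev h)); rewrite rcons_path last_rcons size_rcons pq' tgt_erev.
split=> //; try lia.
by apply/nbP; rewrite src_erev lq'; split=> // /erev_inj.
Qed.

Section NoReversal.
Variables (e : edge X) (K : nat).
Hypothesis noK : ~ reaches K e (erev e).

(** A path from e to [erev g] can be read backwards, from g to [erev e].  So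
    if e does not lead to its reverse, then the edges reachable from e, its
    forward cone, contain no pair of opposite edges, as long as the depths of
    the two add up to at most K. *)
Lemma reaches_no_erev a b g :
  reaches a e g -> reaches b e (erev g) -> (a + b <= K)%N -> False.
Proof.
move=> eg /reaches_erev; rewrite erevK => ge abK; apply: noK.
exact: reaches_leq abK (reaches_trans eg ge).
Qed.

(** If g and h are distinct with the same end, then g may be followed by
    [erev h].  Hence the forward cone of an edge that is not reversed enters
    every vertex at most once: it is a tree, or a directed cycle with trees
    attached. *)
Lemma reaches_tgt_inj a b g h : reaches a e g -> reaches b e h ->
  tgt g = tgt h -> (a + b < K)%N -> g = h.
Proof.
move=> eg eh gh abK; apply/eqP/negPn/negP => /eqP ngh.
apply: (reaches_no_erev (g := h) eh (b := a.+1)); last by lia.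
apply: reachesS eg _; apply/nbP; rewrite src_erev.
by split=> // /erev_inj /esym.
Qed.

(** Predecessors in the cone are unique, so a path that ends on the cycle c
    has been on c all along. *)
Lemma cycle_pulls_back n a b c f p : cycle (@nb X) c ->
  {in c, forall h, reaches n e h} ->
  reaches a e f -> path (@nb X) f p -> (size p <= b)%N -> last f p \in c ->
  (a + b + n < K)%N -> f \in c.
Proof.
move=> cc cn ef + + + K'; elim/last_ind: p => // p h IHp.
rewrite rcons_path last_rcons size_rcons => /andP[pp lh] sp hc.
apply: IHp => //; first exact: ltnW.
have phc : prev c h \in c by rewrite mem_prev.
suff -> : last f p = prev c h by [].
have fl : reaches b f (last f p) by exists p; split=> //; apply: ltnW.
apply: (reaches_tgt_inj (reaches_trans ef fl) (cn _ phc)) => //.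
by case/nbP: lh => <- _; case/nbP: (cycle_prev cc hc).
Qed.
End NoReversal.

(** If e is not reversed, follow any path of length r from e, to a vertex w.
    Every vertex within distance r of w is the end of an edge of the cone of e
    ([walk_from_path]).  So each edge of a cycle in this ball starts where an
    edge of the cone ends, and it either continues that edge, hence lies in the
    cone, or is its reverse.  In the cone either the cycle or its reverse runs
    entirely, and e lies on it by [cycle_pulls_back]. *)
Lemma reversal_or_cycle r e :
  graph_connected X -> (forall x, contains_cycle (gball x r)) ->
  reaches (4 * r + 2) e (erev e) \/
  exists c, [/\ cycle (@nb X) c, uniq c, e \in c &
    {in c, forall h, reaches (2 * r) e h}].
Proof.
move=> conn dense; apply/or_asboolP; rewrite -implyNb; apply/implyP => /asboolPn noK.
apply/asboolP.
have [q pq sq] := path_nb_extend r e.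
pose w := tgt (last e q).
have ball z : gball w r z -> exists2 g, reaches (2 * r) e g & tgt g = z.
  rewrite /gball /= => zw; have [[p wp sp] _] := distP z w conn.
  have spr : (size p <= r)%N by rewrite sp.
  have [q' [pq' lq' _ hi]] := walk_from_path wp spr pq sq erefl.
  by exists (last e q') => //; exists q'; split=> //; move: hi; rewrite sp; lia.
have [c /and3P[c0 cc /map_uniq uc] cb] := dense w.
have enter h : h \in c -> exists2 g, reaches (2 * r) e g & tgt g = src h.
  by move/cb/ball.
suff [c' [cc' uc' c'0 c'D]] : exists c', [/\ cycle (@nb X) c', uniq c', c' != [::] &
    {in c', forall h, reaches (2 * r) e h}].
  exists c'; split=> //.
  case: c' => // h c' in cc' uc' c'0 c'D *.
  have hc : h \in h :: c' by rewrite inE eqxx.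
  have [p [pp lp sp]] := c'D _ hc.
  apply: (cycle_pulls_back noK cc' c'D (reaches_refl 0 e) pp sp); last by lia.
  by rewrite lp.
have [[h hc hD]|none] := pselect (exists2 h, h \in c & reaches (2 * r).+1 e h).
  (* The cone enters the end of f by f and by the edge g of depth at most 2 r;
     these coincide, so the depth does not grow along the cycle. *)
  have step f : f \in c -> reaches (2 * r).+1 e f ->
      reaches (2 * r) e f /\ reaches (2 * r).+1 e (next c f).
    move=> fc fD; have nf : next c f \in c by rewrite mem_next.
    have [g gD gn] := enter _ nf.
    have fn := next_cycle cc fc; have [sn _] := nbP _ _ fn.
    have fg : f = g by apply: (reaches_tgt_inj noK fD gD); rewrite ?gn; lia || done.
    by rewrite fg in fn *; split=> //; apply: reachesS gD fn.
  exists c; split=> // f fc.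
  have := cycle_propagate uc hc hD (fun f fc fD => (step f fc fD).2) fc.
  by case/(step _ fc).
exists (rev (map erev c)); split.
- exact: cycle_nb_rev.
- by rewrite rev_uniq map_inj_uniq //; apply: erev_inj.
- by rewrite -size_eq0 size_rev size_map size_eq0.
move=> h; rewrite mem_rev => /mapP[f fc ->].
have [g gD gf] := enter _ fc.
have [fg|/eqP fg] := eqVneq f (erev g); first by rewrite fg erevK.
case: none; exists f => //; apply: reachesS gD _; exact/nbP.
Qed.

(** Nothing leaves such a cycle, so by connectedness it is the whole graph. *)
Lemma cycle_deg2_covers c : graph_connected X -> c != [::] ->
  cycle (@nb X) c -> {in c, forall h, deg (tgt h) = 2} ->
  forall z, exists2 h, h \in c & tgt h = z.
Proof.
move=> conn c0 cc c2 z.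
have [h hc] : exists h, h \in c.
  by case: c c0 {cc c2} => // h c _; exists h; rewrite inE eqxx.
have [p] := conn (tgt h) z; elim: p h hc => [|e p IHp] h hc /=.
  by move/eqP; exists h.
case/andP=> /eqP se; have hn := next_cycle cc hc.
have nc : next c h \in c by rewrite mem_next.
have : e \in [fset erev h; next c h]%fset.
  suff /eqP -> : [fset erev h; next c h]%fset == out (tgt h).
    by rewrite mem_out se.
  case/nbP: hn => sn nh; rewrite eqEfcard; apply/andP; split.
    apply/fsubsetP => g; rewrite !inE mem_out => /orP[] /eqP -> //.
      by rewrite src_erev.
    exact/eqP.
  by rewrite -/(deg _) c2 // cardfs2 eq_sym; case: eqP nh.
rewrite !inE => /orP[] /eqP ->; last exact: IHp.
rewrite tgt_erev; have [-> _] := nbP _ _ (cycle_prev cc hc).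
by apply: IHp; rewrite mem_prev.
Qed.

(** An edge e that is not reversed lies on a directed cycle c in its cone.  As
    some degree is not 2, c does not consist of vertices of degree 2 only
    ([cycle_deg2_covers]), so the cone leaves c, by an edge f following some h
    of c.  If f were reversed, e would be reversed through f; so f lies on a
    cycle of its own.  Going backwards from f, this cycle passes through h and
    therefore coincides with c, which would then leave the end of h twice. *)
Lemma uniform_reversal : graph_connected X -> small_cycles_dense X ->
  (exists x : X, deg x <> 2) -> exists K, forall e, reaches K e (erev e).
Proof.
(* Reversing f takes at most 4 r + 2 steps; going from e to f, and finally
   from [erev f] to [erev e], takes at most 2 r + 1 steps each. *)
move=> conn [r _ dense] [x0 dx0]; exists (8 * r + 4) => e.
apply: contrapT => noK.
have [eK|[c [cc uc ec cD]]] := reversal_or_cycle e conn dense.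
  by apply: noK; apply: reaches_leq eK; lia.
have [h hc dh] : exists2 h, h \in c & (2 < deg (tgt h))%N.
  apply: contrapT => none; apply: dx0.
  have c2 : {in c, forall h, deg (tgt h) = 2}.
    move=> h hc; apply/eqP; rewrite eqn_leq deg2 andbT leqNgt.
    by apply/negP => dh; apply: none; exists h.
  have c0 : c != [::] by case: c ec {cc uc cD c2 none}.
  by have [h hc <-] := cycle_deg2_covers conn c0 cc c2 x0; apply: c2.
have [|f hf] := @nb_fresh h [fset next c h]%fset.
  by rewrite cardfs1; lia.
rewrite inE => /eqP fn; have ef := reachesS (cD _ hc) hf.
have [fK|[c' [cc' uc' fc' cD']]] := reversal_or_cycle f conn dense.
  by apply: (reaches_no_erev noK ef (reaches_trans ef fK)); lia.
have prev_f g : reaches (4 * r + 1) e g -> nb g f -> g = h.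
  move=> eg /nbP[fg _]; apply: (reaches_tgt_inj noK eg (cD _ hc)); last by lia.
  by rewrite -fg; case/nbP: hf.
have hc' : h \in c'.
  rewrite -(prev_f (prev c' f)) ?mem_prev ?cycle_prev //.
  have fp : reaches (2 * r) f (prev c' f) by apply: cD'; rewrite mem_prev.
  by apply: reaches_leq (reaches_trans ef fp); lia.
have fc : f \in c.
  have [p [pp lp sp]] := cD' _ hc'.
  apply: (cycle_pulls_back noK cc cD ef pp sp); last by lia.
  by rewrite lp.
apply: fn; rewrite -(prev_f (prev c f)) ?cycle_prev ?next_prev //.
by apply: reaches_leq (cD _ _); rewrite ?mem_prev //; lia.
Qed.

End MinDeg2.

(** Two distinct edges e, f that leave the same vertex are connected through
    e, [erev e], f; an edge h is connected through its reverse to the edges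
    that leave its end.  So reachability follows walks. *)
Lemma reaches_all K : graph_connected X ->
  (forall e, reaches K e (erev e)) ->
  forall e f, exists n, reaches n e f.
Proof.
move=> conn rK e f.
have same_src e' f' : src e' = src f' -> exists n, reaches n e' f'.
  move=> ef; have [->|/eqP fe] := eqVneq f' e'.
    by exists 0%N; apply: reaches_refl.
  exists K.+1; apply: reachesS (rK e') _; apply/nbP.
  by rewrite tgt_erev erevK.
have [p] := conn (src e) (src f); elim: p e => [|h p IHp] e /=.
  by move/eqP/same_src.
case/andP=> /eqP he; rewrite -src_erev => /IHp[n hf].
have [m eh] := same_src e h (esym he).
exists (m + (K + n))%N; apply: reaches_trans eh _.
exact: reaches_trans (rK h) hf.
Qed.

Lemma cycle_arbitrarily_long c e f n : cycle (@nb X) c -> e \in c -> f \in c ->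
  exists p, [/\ path (@nb X) e p, last e p = f & (n <= size p)%N].
Proof.
move=> cc ec fc; elim: n => [|n [p [pp lp np]]].
  by have [n [p [pp lp _]]] := reaches_cycle cc ec fc; exists p.
have fn := next_cycle cc fc; have nc : next c f \in c by rewrite mem_next.
have [m [q [pq lq _]]] := reaches_cycle cc nc fc.
exists (p ++ next c f :: q); rewrite cat_path pp last_cat lp /= fn pq.
by split=> //; rewrite size_cat /= addnS ltnS (leq_trans np) ?leq_addr.
Qed.

End Reachability.

Import Order.TTheory GRing.Theory Num.Theory.
Import numFieldNormedType.Exports.
Local Open Scope classical_set_scope.
Local Open Scope fset_scope.
Local Open Scope ring_scope.

(** * Sums over finite sets *)

Section FsetSums.
Variables (R : realType) (T : choiceType).
Implicit Types (A B : {fset T}) (h : T -> R).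

Lemma ler_sum_fset A B h : {in B, forall t, 0 <= h t} ->
  (forall t, t \in A -> t \notin B -> h t = 0) ->
  \sum_(t <- A) h t <= \sum_(t <- B) h t.
Proof.
move=> h0 hA; rewrite (big_fsetID _ (mem B) A) (big_fsetID _ (mem A) B) /=.
have -> : [fset x | x in A & x \in B] = [fset x | x in B & x \in A].
  by apply/fsetP => t; rewrite !inE /= andbC.
rewrite lerD2l big1_seq => [|t /=].
  by rewrite big_seq; apply: sumr_ge0 => t; rewrite !inE /= => /andP[/h0].
by rewrite !inE /= => /andP[tA tB]; apply: hA.
Qed.

Lemma eq_sum_fset A B h : (forall t, t \in A -> t \notin B -> h t = 0) ->
  (forall t, t \in B -> t \notin A -> h t = 0) ->
  \sum_(t <- A) h t = \sum_(t <- B) h t.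
Proof.
move=> hA hB; rewrite (big_fsetID _ (mem B) A) (big_fsetID _ (mem A) B) /=.
have -> : [fset x | x in A & x \in B] = [fset x | x in B & x \in A].
  by apply/fsetP => t; rewrite !inE /= andbC.
congr (_ + _); rewrite !big1_seq // => t /=.
  by rewrite !inE /= => /andP[? ?]; apply: hB.
by rewrite !inE /= => /andP[? ?]; apply: hA.
Qed.

Lemma ler_sum_in A (h k : T -> R) : {in A, forall t, h t <= k t} ->
  \sum_(t <- A) h t <= \sum_(t <- A) k t.
Proof. by move=> hk; rewrite big_seq [leRHS]big_seq; apply: ler_sum. Qed.

Lemma eq_sum_in A (h k : T -> R) : {in A, forall t, h t = k t} ->
  \sum_(t <- A) h t = \sum_(t <- A) k t.
Proof. by move=> hk; rewrite big_seq [RHS]big_seq; apply: eq_bigr. Qed.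

Lemma sum_fset_const A (c : R) : \sum_(t <- A) c = (#|` A|)%:R * c.
Proof. by rewrite big_const_seq count_predT iter_addr_0 mulr_natl. Qed.

Lemma sum_fset_ge0 A h : {in A, forall t, 0 <= h t} -> 0 <= \sum_(t <- A) h t.
Proof. by move=> h0; rewrite big_seq; apply: sumr_ge0. Qed.

Lemma ler_sum_single A h t : {in A, forall s, 0 <= h s} -> t \in A ->
  h t <= \sum_(s <- A) h s.
Proof.
move=> h0 tA; rewrite (big_fsetD1 t tA) /= lerDl; apply: sum_fset_ge0 => s.
by rewrite !inE => /andP[_ /h0].
Qed.

Lemma sum_fset_delta A h t : \sum_(s <- A) (t == s)%:R * h s = (t \in A)%:R * h t.
Proof.
have [tA|tA] := boolP (t \in A); last first.
  rewrite mul0r big1_seq // => s /= sA; case: eqP => [ts|]; last by rewrite mul0r.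
  by rewrite ts sA in tA.
rewrite (big_fsetD1 t tA) /= eqxx big1_seq ?addr0 // => s /=.
by rewrite !inE eq_sym => /andP[/negPf -> _]; rewrite mul0r.
Qed.

Lemma fset_argmax A h : A != fset0 ->
  exists2 t, t \in A & {in A, forall s, h s <= h t}.
Proof.
move=> /fset0Pn[t0 t0A].
have [[t tA] _ tmax] := arg_maxP (fun s : A => h (val s)) (erefl : xpredT [` t0A]).
by exists t => // s sA; apply: (tmax [` sA]).
Qed.

Lemma card_fset_filter A (P : pred T) :
  (#|` [fset t in A | P t]|)%:R = \sum_(t <- A) (P t)%:R :> R.
Proof.
rewrite -[LHS]mulr1 -sum_fset_const (big_fsetID _ P A) /=.
rewrite [X in _ = _ + X]big1_seq ?addr0 => [|t /=]; last first.
  by rewrite !inE /= => /andP[_ /negPf ->].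
by apply: eq_sum_in => t; rewrite !inE /= => /andP[_ ->].
Qed.

(** By the inequality of arithmetic and geometric means,
    2 <= G t / G s + G s / G t; by symmetry of W both terms contribute the same
    amount. *)
Lemma schur_test (A : {fset T}) (W : T -> T -> R) (G : T -> R) (c : R) :
  (forall s t, 0 <= W s t) -> (forall s t, W s t = W t s) ->
  (forall t, 0 < G t) ->
  (forall s, \sum_(t <- A) W s t * G t <= c * G s) ->
  \sum_(s <- A) \sum_(t <- A) W s t <= c * (#|` A|)%:R.
Proof.
move=> W0 Wsym G0 WG.
pose V s t := W s t * G t / G s.
have key s t : W s t <= 2^-1 * V s t + 2^-1 * V t s.
  have -> : 2^-1 * V s t + 2^-1 * V t s =
      W s t + W s t * ((G s - G t) ^+ 2 / (2 * (G s * G t))).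
    by rewrite /V [W t s]Wsym; field; rewrite !gt_eqF.
  rewrite lerDl mulr_ge0 // divr_ge0 ?sqr_ge0 //.
  by rewrite !mulr_ge0 // ltW.
apply: (@le_trans _ _ (\sum_(s <- A) \sum_(t <- A) V s t)).
  have -> : \sum_(s <- A) \sum_(t <- A) V s t =
      \sum_(s <- A) \sum_(t <- A) (2^-1 * V s t + 2^-1 * V t s).
    under [RHS]eq_bigr do rewrite big_split.
    rewrite big_split /= [X in _ = _ + X]exchange_big /= -big_split /=.
    apply: eq_bigr => s _; rewrite -big_split /=; apply: eq_bigr => t _.
    by field.
  by apply: ler_sum_in => s _; apply: ler_sum_in => t _.
rewrite mulrC -sum_fset_const; apply: ler_sum_in => s _.
by rewrite -mulr_suml ler_pdivrMr.
Qed.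

End FsetSums.

(** * The transition matrix on oriented edges *)

Section Kernel.
Variables (R : realType) (X : graph).
Hypothesis deg2 : forall x : X, (2 <= deg x)%N.
Implicit Types (x y z w : X) (e f g h : edge X) (p c : seq (edge X))
  (S : {fset edge X}).

Local Notation Q := (@QE X R).
Local Notation Qn := (@QEn X R).

Lemma QE_ge0 e f : 0 <= Q e f.
Proof. by rewrite /QE; case: ifP. Qed.

Lemma QEn_ge0 n e f : 0 <= Qn n e f.
Proof.
elim: n e => [|n IHn] e /=; first by rewrite ler0n.
by apply: sum_fset_ge0 => g _; rewrite mulr_ge0 ?QE_ge0.
Qed.

(** A step from e to f and the reversed step from [erev f] to [erev e] branch
    at the same vertex, hence have the same probability. *)
Lemma QE_erev e f : Q (erev f) (erev e) = Q e f.
Proof. by rewrite /QE nb_erev tgt_erev; case: ifP => // /nbP[-> _]. Qed.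

Lemma QE_out e f : f \notin out (tgt e) -> Q e f = 0.
Proof. by rewrite mem_out /QE /nb => /negPf ->. Qed.

Lemma QE_into e f : e \notin into (src f) -> Q e f = 0.
Proof. by rewrite mem_into eq_sym /QE /nb => /negPf ->. Qed.

Lemma QE_row e : \sum_(f <- out (tgt e)) Q e f = 1.
Proof.
have re : erev e \in out (tgt e) by rewrite mem_out src_erev.
have re0 : Q e (erev e) = 0 by rewrite /QE /nb eqxx andbF.
rewrite (big_fsetD1 _ re) /= re0 add0r.
rewrite (eq_sum_in (k := fun=> ((deg (tgt e)).-1)%:R^-1)) => [|f].
  rewrite sum_fset_const; have := cardfsD1 (erev e) (out (tgt e)).
  rewrite re -/(deg _) => ->; rewrite add1n /= mulfV // pnatr_eq0 -lt0n.
  by rewrite cardfs_gt0; apply/fset0Pn; have [f /nbP[sf fe]] := nb_extend deg2 e;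
    exists f; rewrite !inE mem_out sf eqxx andbT; apply/eqP.
by rewrite !inE mem_out /QE /nb => /andP[-> ->].
Qed.

Lemma QE_col f : \sum_(e <- into (src f)) Q e f = 1.
Proof.
rewrite sum_into -(QE_row (erev f)) tgt_erev; apply: eq_bigr => e _.
by rewrite -QE_erev erevK.
Qed.

Lemma QE_col_le S f : \sum_(e <- S) Q e f <= 1.
Proof.
rewrite -(QE_col f); apply: ler_sum_fset => e; first by rewrite QE_ge0.
by move=> _; apply: QE_into.
Qed.

Lemma QEnSr n e f :
  Qn n.+1 e f = \sum_(g <- into (src f)) Qn n e g * Q g f.
Proof.
elim: n e => [|n IHn] e.
  transitivity (Q e f).
    rewrite [LHS]/= (eq_sum_in (k := fun g => (f == g)%:R * Q e g)).
      rewrite sum_fset_delta; case: (boolP (f \in _)); first by rewrite mul1r.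
      by move/QE_out ->; rewrite mulr0.
    by move=> g _; rewrite mulrC eq_sym.
  rewrite /= sum_fset_delta; case: (boolP (e \in _)); first by rewrite mul1r.
  by move/QE_into ->; rewrite mulr0.
have -> : Qn n.+2 e f = \sum_(g <- out (tgt e)) Q e g * Qn n.+1 g f by [].
under eq_bigr do rewrite IHn mulr_sumr.
rewrite exchange_big; apply: eq_bigr => h _ /=.
by rewrite mulr_suml; apply: eq_bigr => g _; rewrite mulrA.
Qed.

Lemma QEn_erev n e f : Qn n (erev f) (erev e) = Qn n e f.
Proof.
elim: n e => [|n IHn] e; first by rewrite /= (inj_eq (@erev_inj X)) eq_sym.
rewrite QEnSr src_erev sum_into; apply: eq_bigr => g _.
by rewrite IHn QE_erev mulrC.
Qed.

Lemma QEn_row_le n S e : \sum_(f <- S) Qn n e f <= 1.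
Proof.
elim: n e => [|n IHn] e /=.
  under eq_bigr do rewrite -[_%:R]mulr1.
  by rewrite sum_fset_delta mulr1; case: (_ \in _); rewrite ?lexx ?ler01.
rewrite exchange_big /= -(QE_row e); apply: ler_sum_in => g _.
by rewrite -mulr_sumr ler_piMr ?QE_ge0.
Qed.

Lemma QEn_le1 n e f : Qn n e f <= 1.
Proof. by have := QEn_row_le n [fset f] e; rewrite big_seq_fset1. Qed.

(** Chapman-Kolmogorov, as an inequality because the intermediate edge is
    confined to a finite set. *)
Lemma QEn_comp a b S e f :
  \sum_(g <- S) Qn a e g * Qn b g f <= Qn (a + b) e f.
Proof.
elim: a e => [|a IHa] e.
  rewrite /= sum_fset_delta; case: (_ \in _); rewrite ?mul1r // mul0r.
  exact: QEn_ge0.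
rewrite addSn /=; under eq_bigr do rewrite mulr_suml.
rewrite exchange_big /=; apply: ler_sum_in => g _.
under eq_bigr do rewrite -mulrA.
by rewrite -mulr_sumr ler_wpM2l ?QE_ge0.
Qed.

Lemma QEn_comp1 a b e g f : Qn a e g * Qn b g f <= Qn (a + b) e f.
Proof. by have := QEn_comp a b [fset g] e f; rewrite big_seq_fset1. Qed.

Lemma nbrw_le1 n x y : nbrw R n x y <= 1.
Proof.
case: n => [|n] /=; first by rewrite lern1 leq_b1.
have dx : (0 : R) < (deg x)%:R by rewrite ltr0n ltnW.
apply: (@le_trans _ _ (\sum_(e <- out x) (deg x)%:R^-1)).
  by apply: ler_sum_in => e _; rewrite ler_piMr ?invr_ge0 ?QEn_row_le ?ltW.
by rewrite sum_fset_const -/(deg x) mulfV ?gt_eqF.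
Qed.

Lemma nbrw_ge0 n x y : 0 <= nbrw R n x y.
Proof.
case: n => [|n] /=; first by rewrite ler0n.
apply: sum_fset_ge0 => e _; rewrite mulr_ge0 ?invr_ge0 //.
by apply: sum_fset_ge0 => f _; apply: QEn_ge0.
Qed.

Lemma nbrw_le n x y (B : R) : (forall e f, Qn n e f <= B) ->
  nbrw R n.+1 x y <= (deg y)%:R * B.
Proof.
move=> QB; have dx : (0 : R) < (deg x)%:R by rewrite ltr0n ltnW.
apply: (@le_trans _ _ (\sum_(e <- out x) (deg x)%:R^-1 * ((deg y)%:R * B))).
  apply: ler_sum_in => e _; rewrite ler_wpM2l ?invr_ge0 ?ler0n //.
  by rewrite sum_into /deg -sum_fset_const; apply: ler_sum_in.
by rewrite sum_fset_const -/(deg x) mulrA mulfV ?mul1r ?gt_eqF.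
Qed.

Section BoundedDegree.
Variable M : nat.
Hypothesis degM : forall x : X, (deg x <= M)%N.

Lemma QE_ge e f : nb e f -> (M.-1)%:R^-1 <= Q e f.
Proof.
move=> ef; rewrite /QE ef lef_pV2 ?posrE ?ltr0n ?ler_nat.
- by rewrite -!subn1 leq_sub2r.
- by have := deg2 (tgt e); have := degM (tgt e); lia.
- by have := deg2 (tgt e); lia.
Qed.

Lemma QEn_path e p : path (@nb X) e p ->
  (M.-1)%:R^-1 ^+ size p <= Qn (size p) e (last e p).
Proof.
elim: p e => [|f p IHp] e /=; first by rewrite eqxx.
case/andP=> ef /IHp Qp; rewrite exprS.
have fo : f \in out (tgt e) by rewrite mem_out; case/nbP: ef => ->.
refine (le_trans _ (ler_sum_single _ fo)); last first.
  by move=> g _; rewrite mulr_ge0 ?QE_ge0 ?QEn_ge0.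
by apply: ler_pM => //; rewrite ?exprn_ge0 ?QE_ge.
Qed.

(** The walk may choose e first and then follow p. *)
Lemma nbrw_ge l x y e p f : src e = x -> path (@nb X) e p -> tgt f = y ->
  M%:R^-1 * (M.-1)%:R^-1 ^+ size p * Qn l (last e p) f
    <= nbrw R (size p + l).+1 x y.
Proof.
move=> ex pp fy; have eo : e \in out x by rewrite mem_out ex.
have fi : f \in into y by rewrite mem_into fy.
have s0 g : 0 <= \sum_(f <- into y) Qn (size p + l) g f.
  by apply: sum_fset_ge0 => h _; apply: QEn_ge0.
have dx : (0 : R) < (deg x)%:R by rewrite ltr0n ltnW.
refine (le_trans _ (ler_sum_single _ eo)); last first.
  by move=> g _; rewrite mulr_ge0 ?invr_ge0.
rewrite -mulrA; apply: ler_pM; rewrite ?invr_ge0 //.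
- by rewrite mulr_ge0 ?exprn_ge0 ?QEn_ge0.
- by rewrite lef_pV2 ?posrE ?ler_nat // ltr0n (leq_trans _ (degM x)) // ltnW.
refine (le_trans _ (ler_sum_single _ fi)); last by move=> g _; apply: QEn_ge0.
apply: le_trans (QEn_comp1 _ _ _ (last e p) _).
by rewrite ler_wpM2r ?QEn_ge0 ?QEn_path.
Qed.

End BoundedDegree.
End Kernel.

(** * The isoperimetric inequality and the spectral gap *)

Section OutEdges.
Variables (R : realType) (X : graph).
Implicit Types (x y z w : X) (e f g h : edge X) (F : {fset X}).

Definition outs F : {fset edge X} := \bigcup_(x <- F) out x.

Lemma mem_outs F e : (e \in outs F) = (src e \in F).
Proof.
apply/bigfcupP/idP => [[x /andP[xF _]]|eF].
  by rewrite mem_out => /eqP ->.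
by exists (src e); rewrite ?eF // mem_out.
Qed.

Lemma sum_outs F (u : edge X -> R) :
  \sum_(e <- outs F) u e = \sum_(x <- F) \sum_(e <- out x) u e.
Proof.
rewrite partition_disjoint_bigfcup // => x y _ _ xy; apply/fdisjointP => e.
by rewrite !mem_out => /eqP ->.
Qed.

Lemma VolE F : (Vol F)%:R = \sum_(x <- F) (deg x)%:R :> R.
Proof. by rewrite /Vol natr_sum. Qed.

Lemma AreaE F :
  (Area F)%:R = \sum_(x <- F) \sum_(e <- out x) (tgt e \notin F)%:R :> R.
Proof.
rewrite /Area natr_sum; apply: eq_bigr => x _.
by rewrite card_fset_filter.
Qed.

(** Layer-cake argument: split u into m times the indicator of F, where m is
    the minimum of u on F, and a function with smaller support.  The first part
    satisfies the inequality by hypothesis, the second one by induction, and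
    both sides are additive for this splitting. *)
Lemma isoperimetric_functional (i : R) :
  (forall F, F != fset0 -> i * (Vol F)%:R <= (Area F)%:R) ->
  forall F (u : X -> R), (forall x, 0 <= u x) ->
  (forall x, x \notin F -> u x = 0) ->
  i * \sum_(x <- F) (deg x)%:R * u x <=
  \sum_(x <- F) \sum_(e <- out x) Num.max 0 (u x - u (tgt e)).
Proof.
move=> iso F; have [n] := ubnP #|` F|; elim: n F => // n IHn F Fn u u0 uF.
have [->|F0] := eqVneq F fset0; first by rewrite !big_seq_fset0 mulr0.
have [x0 x0F x0min] := fset_argmax (fun x => - u x) F0.
pose m := u x0; pose u' x := if x \in F then u x - m else 0.
have um x : x \in F -> m <= u x by move/x0min; rewrite lerN2.
have u'0 x : 0 <= u' x by rewrite /u'; case: ifP => // /um; rewrite subr_ge0.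
have u'x0 : u' x0 = 0 by rewrite /u' x0F subrr.
have IH : i * \sum_(x <- F) (deg x)%:R * u' x <=
    \sum_(x <- F) \sum_(e <- out x) Num.max 0 (u' x - u' (tgt e)).
  rewrite (big_fsetD1 x0 x0F) /= u'x0 mulr0 add0r (big_fsetD1 x0 x0F) /=.
  rewrite -[leLHS]add0r lerD //.
    by apply: sum_fset_ge0 => e _; rewrite le_max lexx.
  apply: IHn => //; first by rewrite (cardfsD1 x0) x0F in Fn.
  move=> x; rewrite !inE /u' negb_and negbK => /orP[/eqP ->|/negPf -> //].
  by rewrite x0F subrr.
have -> : \sum_(x <- F) (deg x)%:R * u x =
    \sum_(x <- F) (deg x)%:R * u' x + m * (Vol F)%:R.
  rewrite VolE mulr_sumr -big_split /=; apply: eq_sum_in => x xF.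
  by rewrite /u' xF; ring.
have -> : \sum_(x <- F) \sum_(e <- out x) Num.max 0 (u x - u (tgt e)) =
    \sum_(x <- F) \sum_(e <- out x) Num.max 0 (u' x - u' (tgt e))
    + m * (Area F)%:R.
  rewrite AreaE mulr_sumr -big_split /=; apply: eq_sum_in => x xF.
  rewrite mulr_sumr -big_split /=; apply: eq_sum_in => e _.
  rewrite /u' xF; case: ifPn => tF /=.
    rewrite mulr0 addr0; suff -> : u x - m - (u (tgt e) - m) = u x - u (tgt e) by [].
    by ring.
  rewrite (uF _ tF) !subr0 mulr1 !max_r ?subr_ge0 ?um //; by rewrite subrK.
rewrite mulrDr lerD // mulrCA ler_wpM2l ?iso //; exact: u0.
Qed.

End OutEdges.

Section SpectralGap.
Variables (R : realType) (X : graph) (M : nat) (i : R).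
Hypothesis deg2 : forall x : X, (2 <= deg x)%N.
Hypothesis degM : forall x : X, (deg x <= M)%N.
Hypothesis i0 : 0 < i.
Hypothesis iso :
  forall F : {fset X}, F != fset0 -> i * (Vol F)%:R <= (Area F)%:R.
Implicit Types (x y z w : X) (e f g h : edge X) (S : {fset edge X})
  (v : edge X -> R).

Local Notation Q := (@QE X R).
Local Notation Qn := (@QEn X R).
Local Notation mu := ((M.-1)%:R : R).

Definition grad v e : R :=
  \sum_(f <- out (tgt e)) Q e f * `|v e ^+ 2 - v f ^+ 2|.

Lemma grad_ge0 v e : 0 <= grad v e.
Proof. by apply: sum_fset_ge0 => f _; rewrite mulr_ge0 ?QE_ge0. Qed.

Lemma le_grad v e f : (0 < M.-1)%N -> nb e f ->
  `|v e ^+ 2 - v f ^+ 2| <= mu * grad v e.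
Proof.
move=> M0 ef; have fo : f \in out (tgt e) by rewrite mem_out; case/nbP: ef => ->.
rewrite mulrC -ler_pdivrMr ?ltr0n // mulrC.
refine (le_trans _ (ler_sum_single _ fo)); last first.
  by move=> g _; rewrite mulr_ge0 ?QE_ge0.
by rewrite ler_wpM2r // (QE_ge R deg2 degM ef).
Qed.

(** Let U x be the maximum of v^2 over the edges leaving x, and let h be an
    edge from x to z.  If the maximum at x is attained at h, then any successor
    of h leaves z and is a competitor for U z; if it is attained at another
    edge e, then [erev h] leaves z and is followed by e.  In both cases
    U x - U z is bounded by the variation of v^2 along a single step that starts
    with h or with [erev h]. *)
Lemma sum_sqr_le_grad v (F : {fset X}) S : (0 < M.-1)%N ->
  (forall e, src e \notin F -> v e = 0) ->
  (forall e, src e \in F -> e \in S /\ erev e \in S) ->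
  i * \sum_(e <- outs F) v e ^+ 2 <= 2 * mu * \sum_(e <- S) grad v e.
Proof.
move=> M0 vF FS.
have exU x : exists u : R, (exists2 e, e \in out x & u = v e ^+ 2) /\
    {in out x, forall e, v e ^+ 2 <= u}.
  have ox : out x != fset0 by rewrite -cardfs_gt0 (leq_trans _ (deg2 x)).
  have [e ex emax] := fset_argmax (fun e => v e ^+ 2) ox.
  by exists (v e ^+ 2); split=> //; exists e.
have [U UP] := choice exU.
have U0 x : 0 <= U x by have [[e _ ->] _] := UP x; rewrite sqr_ge0.
have UF x : x \notin F -> U x = 0.
  have [[e + ->] _] := UP x; rewrite mem_out => /eqP <- /vF ->.
  by rewrite expr0n.
have edge_bound x h : h \in out x ->
    Num.max 0 (U x - U (tgt h)) <= mu * grad v h + mu * grad v (erev h).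
  rewrite mem_out => /eqP hx.
  have mg e : 0 <= mu * grad v e by rewrite mulr_ge0 ?grad_ge0.
  rewrite ge_max addr_ge0 //=; have [[e + ->] _] := UP x.
  have [_ Uz] := UP (tgt h).
  rewrite mem_out => /eqP ex; have [->|/eqP eh] := eqVneq e h.
    have [f hf] := nb_extend deg2 h.
    have /Uz Uf : f \in out (tgt h) by rewrite mem_out; case/nbP: hf => ->.
    apply: le_trans (_ : `|v h ^+ 2 - v f ^+ 2| <= _).
      by apply: le_trans (ler_norm _); rewrite lerD2l lerN2.
    by apply: le_trans (le_grad v M0 hf) _; rewrite lerDl.
  have he : nb (erev h) e by apply/nbP; rewrite tgt_erev erevK ex hx.
  have /Uz Uh : erev h \in out (tgt h) by rewrite mem_out src_erev.
  apply: le_trans (_ : `|v (erev h) ^+ 2 - v e ^+ 2| <= _).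
    by rewrite distrC; apply: le_trans (ler_norm _); rewrite lerD2l lerN2.
  by apply: le_trans (le_grad v M0 he) _; rewrite lerDr.
apply: (@le_trans _ _ (i * \sum_(x <- F) (deg x)%:R * U x)).
  rewrite ler_pM2l // sum_outs; apply: ler_sum_in => x _.
  by rewrite -sum_fset_const; apply: ler_sum_in => e ex; have [_] := UP x; apply.
apply: le_trans (isoperimetric_functional iso U0 UF) _.
apply: (@le_trans _ _ (\sum_(h <- outs F) (mu * grad v h + mu * grad v (erev h)))).
  by rewrite sum_outs; apply: ler_sum_in => x _; apply: ler_sum_in => e /edge_bound.
have -> : 2 * mu * \sum_(e <- S) grad v e =
    \sum_(e <- S) mu * grad v e + \sum_(e <- S) mu * grad v e.
  by rewrite -mulr_sumr; ring.
have mg e : 0 <= mu * grad v e by rewrite mulr_ge0 ?grad_ge0.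
rewrite big_split /= lerD //.
  apply: ler_sum_fset => // e; rewrite mem_outs => /FS[eS _].
  by rewrite eS.
have -> : \sum_(e <- outs F) mu * grad v (erev e) =
    \sum_(e <- [fset erev h | h in outs F]) mu * grad v e.
  by rewrite big_imfset //= => e f _ _; apply: erev_inj.
apply: ler_sum_fset => // e /imfsetP[h /=]; rewrite mem_outs => /FS[_ hS] ->.
by rewrite hS.
Qed.

(** The explicit constant from the Cheeger inequality; i is a lower bound of the
    isoperimetric constant. *)
Definition gap : R := i ^+ 2 / (32 * mu ^+ 2).

Lemma sum_outE v S e : (forall e, e \notin S -> v e = 0) ->
  \sum_(f <- out (tgt e)) Q e f * v f = \sum_(f <- S) Q e f * v f.
Proof.
move=> vS; apply: eq_sum_fset => f _; first by move/vS ->; rewrite mulr0.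
by move/QE_out => ->; rewrite mul0r.
Qed.

Lemma sum_QE_col_le v S : (forall e, e \notin S -> v e = 0) ->
  \sum_(e <- S) \sum_(f <- out (tgt e)) Q e f * v f ^+ 2 <=
  \sum_(e <- S) v e ^+ 2.
Proof.
move=> vS; have vS2 e : e \notin S -> v e ^+ 2 = 0 by move/vS ->; rewrite expr0n.
under eq_bigr do rewrite (sum_outE _ vS2).
rewrite exchange_big /=; apply: ler_sum_in => f _.
by rewrite -mulr_suml ler_piMl ?sqr_ge0 ?QE_col_le.
Qed.

(** Cheeger's inequality: |a^2 - b^2| is bounded by a multiple of (a - b)^2
    plus a small multiple of a^2 + b^2, whose sum is absorbed by the lower
    bound of [sum_sqr_le_grad]; as Q is doubly stochastic, the sum of the
    squares (a - b)^2 is at most twice the difference of |v|^2 and the form. *)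
Lemma QE_form_le v S : (0 < M.-1)%N -> (forall e, e \notin S -> v e = 0) ->
  \sum_(e <- S) v e * \sum_(f <- S) Q e f * v f <=
  (1 - gap) * \sum_(e <- S) v e ^+ 2.
Proof.
move=> M0 vS0.
pose F := [fset src e | e in S]; pose S' := outs F `|` [fset erev e | e in outs F].
have srcF e : e \in S -> src e \in F by move=> eS; apply/imfsetP; exists e.
have SS' e : e \in S -> e \in S' by move=> /srcF eF; rewrite !inE mem_outs eF.
have vS e : e \notin S' -> v e = 0 by move=> eS; apply: vS0; apply: contra eS => /SS'.
have eqS (u : edge X -> R) : (forall e, v e = 0 -> u e = 0) ->
    \sum_(e <- S) u e = \sum_(e <- S') u e.
  by move=> u0; apply: eq_sum_fset => e; [move=> /SS' -> | move=> _ /vS0 /u0].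
have vF e : src e \notin F -> v e = 0.
  by move=> eF; apply: vS0; apply: contra eF => /srcF.
have FS e : src e \in F -> e \in S' /\ erev e \in S'.
  move=> eF; rewrite !inE mem_outs eF; split=> //; apply/orP; right.
  by apply/imfsetP; exists e; rewrite //= mem_outs.
have := sum_sqr_le_grad M0 vF FS.
set N := \sum_(e <- S) v e ^+ 2.
have NE : N = \sum_(e <- S') v e ^+ 2 by apply: eqS => e ->; rewrite expr0n.
have -> : \sum_(e <- outs F) v e ^+ 2 = N.
  rewrite /N; apply: eq_sum_fset => e; last by rewrite mem_outs => /srcF ->.
  by move=> _ /vS0 ->; rewrite expr0n.
set I := \sum_(e <- S) _.
have IE : I = \sum_(e <- S') \sum_(f <- out (tgt e)) Q e f * (v e * v f).
  rewrite /I eqS => [|e ->]; last by rewrite mul0r.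
  apply: eq_bigr => e _; rewrite -sum_outE // mulr_sumr; apply: eq_bigr => f _.
  by rewrite mulrCA.
(* This weight makes the absorbed term equal to half of the lower bound. *)
have t0 : 0 < i / (8 * mu) by rewrite divr_gt0 ?mulr_gt0 ?ltr0n.
set t := i / (8 * mu) in t0.
have grad_le : \sum_(e <- S') grad v e <= (N - I) / t + 2 * t * N.
  (* Expanded so that the sum against Q yields N for each square and I for
     the mixed term. *)
  have point a b : `|a ^+ 2 - b ^+ 2| <=
      (t + 2^-1 / t) * a ^+ 2 + (t + 2^-1 / t) * b ^+ 2 - (a * b) / t :> R.
    have -> : (t + 2^-1 / t) * a ^+ 2 + (t + 2^-1 / t) * b ^+ 2 - (a * b) / t =
        (2^-1 / t) * (a - b) ^+ 2 + t / 2 * (a + b) ^+ 2 + t / 2 * (a - b) ^+ 2.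
      by field; rewrite gt_eqF.
    have tt : (2^-1 / t) * (a - b) ^+ 2 + t / 2 * (a + b) ^+ 2 -
        (a - b) * (a + b) = (2 * t)^-1 * ((a - b) - t * (a + b)) ^+ 2.
      by field; rewrite gt_eqF.
    have tt' : (2^-1 / t) * (a - b) ^+ 2 + t / 2 * (a + b) ^+ 2 +
        (a - b) * (a + b) = (2 * t)^-1 * ((a - b) + t * (a + b)) ^+ 2.
      by field; rewrite gt_eqF.
    have h1 : 0 <= (2 * t)^-1 * ((a - b) - t * (a + b)) ^+ 2.
      by rewrite mulr_ge0 ?sqr_ge0 // invr_ge0 mulr_ge0 // ltW.
    have h2 : 0 <= (2 * t)^-1 * ((a - b) + t * (a + b)) ^+ 2.
      by rewrite mulr_ge0 ?sqr_ge0 // invr_ge0 mulr_ge0 // ltW.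
    have h3 : 0 <= t / 2 * (a - b) ^+ 2.
      by rewrite mulr_ge0 ?sqr_ge0 // divr_ge0 // ltW.
    rewrite subr_sqr ler_norml; apply/andP; split; lra.
  set s := t + 2^-1 / t in point.
  apply: (@le_trans _ _ (s * N + s * \sum_(e <- S') \sum_(f <- out (tgt e))
      Q e f * v f ^+ 2 - I / t)).
    rewrite NE IE !mulr_sumr mulr_suml -sumrN -!big_split /=.
    apply: ler_sum_in => e _.
    rewrite -[s * v e ^+ 2]mul1r -(QE_row R deg2 e) !mulr_sumr !mulr_suml.
    rewrite -sumrN -!big_split /=.
    apply: ler_sum_in => f _; apply: le_trans (ler_wpM2l (QE_ge0 R e f) (point _ _)) _.
    by rewrite !mulrDr mulrN; lra.
  have := sum_QE_col_le vS; rewrite -NE => cle.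
  have s0 : 0 <= s.
    by apply: addr_ge0; [exact: ltW | rewrite mulr_ge0 ?invr_ge0 // ltW].
  have := ler_wpM2l s0 cle.
  have -> : (N - I) / t + 2 * t * N = s * N + s * N - I / t.
    by rewrite /s; field; rewrite gt_eqF.
  by rewrite lerD2r lerD2l.
have mu0 : 0 < mu by rewrite ltr0n.
have mu2 : 0 <= 2 * mu by rewrite mulr_ge0 // ltW.
move=> /le_trans /(_ (ler_wpM2l mu2 grad_le)).
have -> : 2 * mu * ((N - I) / t + 2 * t * N) =
    16 * mu ^+ 2 / i * (N - I) + i / 2 * N.
  by rewrite /t; field; rewrite !gt_eqF.
have -> : (1 - gap) * N = N - gap * N by ring.
move=> h; have : i ^+ 2 / (32 * mu ^+ 2) * N <= N - I.
  have c0 : 0 < 16 * mu ^+ 2 / i by rewrite divr_gt0 ?mulr_gt0 ?exprn_gt0.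
  rewrite -(ler_pM2l c0).
  have -> : 16 * mu ^+ 2 / i * (i ^+ 2 / (32 * mu ^+ 2) * N) = i / 2 * N.
    by field; rewrite !gt_eqF.
  by lra.
rewrite -/gap; lra.
Qed.

Lemma QEn_support n e : exists S, forall f, f \notin S -> Qn n e f = 0.
Proof.
elim: n e => [|n IHn] e.
  by exists [fset e] => f; rewrite inE /= eq_sym => /negPf ->.
have [T TP] := choice IHn; exists (\bigcup_(g <- out (tgt e)) T g) => f fT.
rewrite /= big1_seq // => g /= go; rewrite TP ?mulr0 //.
by apply: contra fT => fg; apply/bigfcupP; exists g; rewrite ?go.
Qed.

Lemma QEn_support_lt n e :
  exists S, forall m f, (m < n)%N -> f \notin S -> Qn m e f = 0.
Proof.
elim: n => [|n [S SP]]; first by exists fset0.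
have [T TP] := QEn_support n e; exists (S `|` T) => m f.
rewrite ltnS leq_eqVlt inE negb_or => /orP[/eqP ->|mn] /andP[fS fT].
  exact: TP.
exact: SP.
Qed.

(** With z = 1 + k, where k is the gap, the partial sum G of the series of
    z^j Q^j(e, f) satisfies G - z (transpose of Q) G <= delta_e.  Pairing with G
    and using the bound of the form gives k^2 |G|^2 <= G e <= |G|, a bound that
    does not depend on the number of terms. *)
Lemma QEn_decay n e f : (0 < M.-1)%N ->
  (1 + gap) ^+ n * Qn n e f <= (gap ^+ 2)^-1.
Proof.
move=> M0; have mu0 : 0 < mu by rewrite ltr0n.
have k0 : 0 < gap by rewrite /gap divr_gt0 ?mulr_gt0 ?exprn_gt0.
set k := gap in k0 *; set z := 1 + k.
have z0 : 0 < z by rewrite addr_gt0.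
pose G f := \sum_(j < n.+1) z ^+ j * Qn j e f.
have [S SP] := QEn_support_lt n.+1 e.
have GS h : h \notin S -> G h = 0.
  by move=> hS; rewrite /G big1 // => j _; rewrite SP // mulr0.
have G0 h : 0 <= G h.
  by apply: sumr_ge0 => j _; rewrite mulr_ge0 ?QEn_ge0 ?exprn_ge0 ?ltW.
set N := \sum_(h <- S) G h ^+ 2.
have GN h : G h ^+ 2 <= N.
  have [hS|/GS ->] := boolP (h \in S).
    by apply: (ler_sum_single (h := fun h => G h ^+ 2)) => // g _; apply: sqr_ge0.
  by rewrite expr0n /= sum_fset_ge0 // => g _; apply: sqr_ge0.
have step h : G h - (e == h)%:R <= z * \sum_(g <- S) G g * Q g h.
  have -> : z * \sum_(g <- S) G g * Q g h =
      \sum_(j < n.+1) z ^+ j.+1 * Qn j.+1 e h.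
    rewrite mulr_sumr; under eq_bigr do rewrite mulr_suml mulr_sumr.
    under [RHS]eq_bigr do rewrite QEnSr.
    rewrite exchange_big; apply: eq_bigr => j _.
    rewrite (eq_sum_fset (A := into (src h)) (B := S)).
    - by rewrite mulr_sumr; apply: eq_bigr => g _; rewrite exprS !mulrA.
    - by move=> g _ gS; rewrite SP ?mul0r.
    - by move=> g _ /QE_into ->; rewrite mulr0.
  rewrite /G big_ord_recl [in leRHS]big_ord_recr /= expr0 mul1r addrAC subrr add0r.
  rewrite lerDl mulr_ge0 ?exprn_ge0 ?(ltW z0) //.
  by have := QEn_ge0 R n.+1 e h.
have kN : k ^+ 2 * N <= G e.
  have form := QE_form_le M0 GS.
  have low : N - G e <= z * \sum_(h <- S) G h * \sum_(g <- S) Q h g * G g.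
    have -> : z * \sum_(h <- S) G h * \sum_(g <- S) Q h g * G g =
        \sum_(g <- S) G g * (z * \sum_(h <- S) G h * Q h g).
      rewrite mulr_sumr; under eq_bigr do rewrite !mulr_sumr.
      rewrite exchange_big /=; apply: eq_bigr => g _.
      by rewrite !mulr_sumr; apply: eq_bigr => h _; ring.
    apply: (@le_trans _ _ (\sum_(g <- S) G g * (G g - (e == g)%:R))).
      under eq_bigr do rewrite mulrBr [_ * (e == _)%:R]mulrC.
      rewrite sumrB sum_fset_delta lerB //.
      by case: (e \in S); rewrite ?mul1r ?mul0r.
    by apply: ler_sum_in => g _; rewrite ler_wpM2l.
  have := le_trans low (ler_wpM2l (ltW z0) form); rewrite -/N -/k /z; nra.
have Ge : k ^+ 2 * G e <= 1.
  have [->|Ge0] := eqVneq (G e) 0; first by rewrite mulr0 ler01.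
  have Gp : 0 < G e by rewrite lt_neqAle eq_sym Ge0 G0.
  rewrite -(ler_pM2r Gp) mul1r -mulrA -expr2.
  by apply: le_trans kN; rewrite ler_wpM2l ?sqr_ge0.
have kG : k ^+ 2 * G f <= 1.
  have kG0 : 0 <= k ^+ 2 * G f by rewrite mulr_ge0 ?sqr_ge0.
  rewrite -(@expr_le1 _ 2) // exprMn.
  apply: le_trans (ler_wpM2l _ (GN f)) _; first by rewrite exprn_ge0 ?sqr_ge0.
  rewrite expr2 -mulrA; apply: le_trans (ler_wpM2l _ kN) Ge.
  exact: sqr_ge0.
rewrite -[leRHS]mul1r ler_pdivlMr ?exprn_gt0 // mulrC.
apply: le_trans (ler_wpM2l (sqr_ge0 _) _) kG.
rewrite /G big_ord_recr /= lerDr; apply: sumr_ge0 => j _.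
by rewrite mulr_ge0 ?QEn_ge0 ?exprn_ge0 ?ltW.
Qed.

End SpectralGap.

(** * The exponential rate *)

Section Rate.
Variables (R : realType).

Lemma exprn_small (r B : R) : 0 <= r < 1 -> 0 < B ->
  exists N, forall n, (N <= n)%N -> r ^+ n < B.
Proof.
move=> /andP[r0 r1] B0.
have /(@cvgr_lt _ _ _ _ _ 0) /(_ _ B0) : (GRing.exp r : nat -> R) @ \oo --> (0 : R).
  by apply: cvg_expr; rewrite ger0_norm.
by case=> N _ NP; exists N => n; apply: NP.
Qed.

Variable X : graph.
Hypothesis deg2 : forall x : X, (2 <= deg x)%N.
Implicit Types x y : X.

Lemma root_le (a d : R) n : (0 < n)%N -> 0 <= a -> 0 <= d ->
  (a `^ n%:R^-1 <= d) = (a <= d ^+ n).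
Proof.
move=> n0 a0 d0; have nn : n%:R != 0 :> R by rewrite pnatr_eq0 -lt0n.
have an : (a `^ n%:R^-1) ^+ n = a.
  by rewrite -powR_mulrn ?powR_ge0 // -powRrM mulVf // powRr1.
by rewrite -[in RHS]an ler_pXn2r ?nnegrE ?powR_ge0.
Qed.

Lemma rho_le1 x y : (rho R x y <= 1%:E)%E.
Proof.
rewrite /rho /limn_esup /limf_esup; apply: le_trans (_ : _ <= ereal_sup
  [set (nbrw R n x y `^ n%:R^-1)%:E | n in setT])%E _.
  by apply: ereal_inf_lbound; exists setT => //; apply: filterT.
apply: ge_ereal_sup => _ [n _ <-]; rewrite lee_fin.
case: n => [|n]; first by rewrite invr0 powRr0.
by rewrite root_le ?nbrw_ge0 ?expr1n ?nbrw_le1.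
Qed.

Lemma rho_lt1P x y : (rho R x y < 1%:E)%E <->
  exists2 d : R, 0 < d < 1 &
    exists N, forall n, (N <= n)%N -> nbrw R n x y <= d ^+ n.
Proof.
split=> [|[d /andP[d0 d1] [N dN]]].
  case/ereal_inf_lt => _ [V [N _ NV] <-] sup1.
  pose u n : R := nbrw R n x y `^ n%:R^-1.
  have uV n : (N <= n)%N ->
      ((u n)%:E <= ereal_sup [set (nbrw R n x y `^ n%:R^-1)%:E | n in V])%E.
    by move=> Nn; apply: ereal_sup_ubound; exists n => //; apply: NV.
  move: sup1 (uV); case: (ereal_sup _) => [l| |] // l1 uVl; last first.
    by have := uVl N (leqnn N); rewrite leeNy_eq.
  rewrite lte_fin in l1.
  have l0 : 0 <= l by have := uVl N (leqnn N); rewrite lee_fin; apply/le_trans/powR_ge0.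
  exists ((1 + l) / 2); first by lra.
  exists N.+1 => n Nn; rewrite -root_le ?nbrw_ge0 //; last 2 first.
  - exact: leq_trans Nn.
  - by lra.
  have := uVl n (ltnW Nn); rewrite lee_fin /u => h; lra.
apply: (@le_lt_trans _ _ d%:E); last by rewrite lte_fin.
rewrite /rho /limn_esup /limf_esup; apply: le_trans (_ : _ <= ereal_sup
  [set (nbrw R n x y `^ n%:R^-1)%:E | n in [set n | (N.+1 <= n)%N]])%E _.
  by apply: ereal_inf_lbound; eexists; last reflexivity; exists N.+1.
apply: ge_ereal_sup => _ [n /= Nn <-]; rewrite lee_fin root_le ?nbrw_ge0 //.
- exact/dN/ltnW.
- exact: leq_trans Nn.
- exact: ltW.
Qed.

End Rate.

Section CycleCase.
Variables (R : realType) (X : graph).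
Hypothesis conn : graph_connected X.
Hypothesis dense : small_cycles_dense X.

(** All transition probabilities after the first step are 1, and the graph is
    one cycle; the walk that starts in the right direction passes y infinitely
    often. *)
Lemma rho_regular2 (x y : X) : (forall z : X, deg z = 2%N) ->
  ~ (rho R x y < 1%:E)%E.
Proof.
move=> degE; have deg2 (z : X) : (2 <= deg z)%N by rewrite degE.
have degM (z : X) : (deg z <= 2)%N by rewrite degE.
case/(rho_lt1P _ _ _) => d /andP[d0 d1] [N dN].
have [r _ /(_ x)[c /and3P[c0 cc uc] _]] := dense.
have cov := cycle_deg2_covers conn c0 cc (fun h _ => degE (tgt h)).
have [h hc hx] := cov x; have [f fc fy] := cov y.
have nc : next c h \in c by rewrite mem_next.
have nx : src (next c h) = x by have [-> _] := nbP _ _ (next_cycle cc hc).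
have [||N' dN'] := @exprn_small R d 2^-1; rewrite ?invr_gt0 ?(ltW d0) //.
have [p [pp lp np]] := cycle_arbitrarily_long (N + N') cc nc fc.
have := nbrw_ge R deg2 degM 0 nx pp fy.
rewrite lp /= eqxx invr1 expr1n !mulr1 addn0.
have h1 : (N <= (size p).+1)%N by apply/leqW/(leq_trans _ np); apply: leq_addr.
have h2 : (N' <= (size p).+1)%N by apply/leqW/(leq_trans _ np); apply: leq_addl.
move=> /le_trans/(_ (dN _ h1)); rewrite leNgt; apply/negP/negPn.
exact: dN'.
Qed.

End CycleCase.

(** * Amenability *)

Section Amenable.
Variables (R : realType) (X : graph).
Hypothesis deg2 : forall x : X, (2 <= deg x)%N.
Implicit Types (x y : X) (e f g h : edge X) (F : {fset X}).

Local Notation Q := (@QE X R).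
Local Notation Qn := (@QEn X R).

Lemma card_outs F : #|` outs F| = Vol F.
Proof.
apply/eqP; rewrite -(eqr_nat R) VolE -[X in X == _]mulr1 -sum_fset_const.
by rewrite sum_outs; apply/eqP/eq_bigr => x _; rewrite sum_fset_const mulr1.
Qed.

(** Start with the uniform mass on the edges entering F.  One step maps it to
    the uniform mass on the edges leaving F ([reenter]), which differs from the
    former by at most the boundary edges ([leave]); so at most [Area F] is lost
    per step. *)
Lemma outs_mass n F : (Vol F)%:R - n.+1%:R * (Area F)%:R <=
  \sum_(e <- outs F) \sum_(f <- outs F) Qn n (erev e) f.
Proof.
pose b n e := \sum_(f <- outs F) Qn n e f.
have b0 m e : 0 <= b m e by apply: sum_fset_ge0 => f _; apply: QEn_ge0.
have b1 m e : b m e <= 1 by apply: QEn_row_le.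
suff : (Vol F)%:R - n.+1%:R * (Area F)%:R <= \sum_(e <- outs F) b n (erev e) by [].
have reenter m : \sum_(e <- outs F) b m.+1 (erev e) = \sum_(e <- outs F) b m e.
  rewrite !sum_outs; apply: eq_bigr => x _.
  transitivity (\sum_(e <- out x) \sum_(g <- out x) Q (erev e) g * b m g).
    apply: eq_sum_in => e; rewrite mem_out => /eqP ex; rewrite /b /=.
    rewrite exchange_big tgt_erev ex; apply: eq_bigr => g _.
    by rewrite mulr_sumr.
  rewrite exchange_big; apply: eq_sum_in => g; rewrite mem_out => /eqP gx /=.
  rewrite -mulr_suml -(@sum_into X R (fun e => Q e g) x) -gx.
  by rewrite QE_col ?mul1r.
have leave m : \sum_(e <- outs F) b m (erev e) - (Area F)%:R <=
    \sum_(e <- outs F) b m e.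
  rewrite lerBlDr AreaE -sum_outs.
  pose k e := (src e \in F)%:R * (tgt e \in F)%:R * b m e.
  have k0 e : 0 <= k e by rewrite !mulr_ge0.
  apply: (@le_trans _ _ (\sum_(e <- outs F) (k (erev e) + (tgt e \notin F)%:R))).
    apply: ler_sum_in => e; rewrite mem_outs /k src_erev tgt_erev => ->.
    by case: (tgt e \in F); rewrite ?mulr1 ?mul1r ?mul0r ?addr0 ?add0r.
  rewrite big_split lerD2r /=.
  have -> : \sum_(e <- outs F) k (erev e) = \sum_(e <- [fset erev h | h in outs F]) k e.
    by rewrite big_imfset //= => e f _ _; apply: erev_inj.
  apply: (@le_trans _ _ (\sum_(e <- outs F) k e)).
    apply: ler_sum_fset => // e _; rewrite mem_outs /k => /negPf ->.
    by rewrite !mul0r.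
  apply: ler_sum_in => e _; rewrite /k -[leRHS]mul1r ler_wpM2r //.
  by rewrite -natrM mulnb lern1 leq_b1.
elim: n => [|n IHn].
  rewrite mul1r lerBlDr -card_outs AreaE -sum_outs -[_%:R]mulr1 -sum_fset_const.
  rewrite -big_split /=; apply: ler_sum_in => e eF.
  rewrite /b /=; under eq_bigr do rewrite -[_%:R]mulr1.
  rewrite sum_fset_delta mulr1 mem_outs src_erev.
  by case: (_ \in _); rewrite ?addr0 ?add0r.
rewrite reenter; apply: le_trans (leave n); apply: le_trans (lerB IHn (lexx _)).
by rewrite -[n.+2]addn1 natrD mulrDl mul1r opprD addrA.
Qed.

Lemma iota_lbound F : F != fset0 ->
  iota_const X R <= (Area F)%:R / (Vol F)%:R.
Proof.
move=> F0; apply: ge_inf; last by exists F.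
by exists 0 => _ [G _ <-]; rewrite divr_ge0.
Qed.

Lemma Vol_gt0 F : F != fset0 -> (0 < Vol F)%N.
Proof.
case/fset0Pn=> x xF; rewrite /Vol (big_fsetD1 x xF) /= addn_gt0.
by rewrite (leq_trans _ (deg2 x)).
Qed.

Lemma iota_ge0 x : 0 <= iota_const X R.
Proof.
apply: lb_le_inf; last by move=> _ [F _ <-]; rewrite divr_ge0.
exists ((Area [fset x])%:R / (Vol [fset x])%:R); exists [fset x] => //=.
by apply/fset0Pn; exists x; rewrite inE.
Qed.

Lemma amenable_folner x (t : R) : amenable X R -> 0 < t ->
  exists2 F : {fset X}, F != fset0 & (Area F)%:R <= t * (Vol F)%:R.
Proof.
move=> am t0; have [|_ [F /= F0 <-]] := @inf_adherent R
    [set (Area F)%:R / (Vol F)%:R | F in [set F : {fset X} | F != fset0]]%classic t t0.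
  split; last by exists 0 => _ [F _ <-]; rewrite divr_ge0.
  exists ((Area [fset x])%:R / (Vol [fset x])%:R); exists [fset x] => //=.
  by apply/fset0Pn; exists x; rewrite inE.
rewrite -/(iota_const X R) am add0r => /ltW; exists F => //.
by rewrite -ler_pdivrMr // ltr0n Vol_gt0.
Qed.

Variable M : nat.
Hypothesis degM : forall x : X, (deg x <= M)%N.
Hypothesis conn : graph_connected X.
Variable K : nat.
Hypothesis revK : forall e, reaches K e (erev e).
Hypothesis am : amenable X R.

(** The Green function G of z Q with pole f0 satisfies J Q^n G <= c G, where
    c = (M - 1)^K z^-n is below 1/2 for a suitable n: [QG] gains the factor
    z^-n, and [G_erev] loses the factor (M - 1)^K in passing from [erev e] to e.
    Schur's test then contradicts the lower bound of [outs_mass] on a set F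
    chosen for this n. *)
Lemma rho_amenable x y : ~ (rho R x y < 1%:E)%E.
Proof.
case/(rho_lt1P _ _ _) => d /andP[d0 d1] [N dN].
have M2 : (2 <= M)%N := leq_trans (deg2 x) (degM x).
pose mu : R := (M.-1)%:R; have mu0 : 0 < mu by rewrite ltr0n; lia.
have mu1 : 1 <= mu by rewrite ler1n; lia.
have path_gt0 k : 0 < mu^-1 ^+ k by rewrite exprn_gt0 ?invr_gt0.
have [e0 e0x] : exists e, src e = x.
  have /fset0Pn[e] : out x != fset0 by rewrite -cardfs_gt0 (leq_trans _ (deg2 x)).
  by rewrite mem_out => /eqP; exists e.
have [f0 f0y] : exists f, tgt f = y.
  have /fset0Pn[e] : out y != fset0 by rewrite -cardfs_gt0 (leq_trans _ (deg2 y)).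
  by rewrite mem_out => /eqP ey; exists (erev e); rewrite tgt_erev.
have irr := reaches_all conn revK.
(* The path from e0 to e bounds Q^l(e, f0) by a multiple of a probability of
   the walk from x to y; the finitely many l below N are covered by the
   summand 1 / d^N. *)
have decay e : exists2 C : R, 0 < C & forall l, Qn l e f0 <= C * d ^+ l.
  have [m [p [pp lp _]]] := irr e0 e.
  pose c := M%:R^-1 * mu^-1 ^+ size p.
  have c0 : 0 < c by rewrite mulr_gt0 // invr_gt0 ltr0n ltnW.
  have dd n : 0 < d ^+ n by rewrite exprn_gt0.
  exists (c^-1 + (d ^+ N)^-1) => [|l]; first by rewrite addr_gt0 ?invr_gt0.
  rewrite mulrDl; have [Nl|lN] := leqP N l.
    rewrite -[leLHS]addr0 lerD ?mulr_ge0 ?invr_ge0 ?(ltW (dd _)) //.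
    rewrite mulrC ler_pdivlMr // mulrC.
    have := nbrw_ge R deg2 degM l e0x pp f0y; rewrite lp -/c.
    move/le_trans; apply; apply: le_trans (dN _ _) _; first by lia.
    by rewrite ler_wiXn2l ?(ltW d0) ?(ltW d1) //; lia.
  rewrite -[leLHS]add0r lerD ?mulr_ge0 ?invr_ge0 ?(ltW (dd _)) ?(ltW c0) //.
  apply: le_trans (QEn_le1 R deg2 _ _ _) _.
  rewrite [leRHS]mulrC ler_pdivlMr // mul1r.
  by apply: ler_wiXn2l; [exact: ltW | exact: ltW | exact: ltnW].
have [z z1 zd] : exists2 z : R, 1 < z & 0 <= z * d < 1.
  have dV : 1 < d^-1 by rewrite invf_gt1.
  exists ((1 + d^-1) / 2); first by lra.
  have -> : (1 + d^-1) / 2 * d = (d + 1) / 2 by field; rewrite gt_eqF.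
  by lra.
have z0 : 0 < z by lra.
pose S e : nat -> R := series (fun l => z ^+ l * Qn l e f0).
have SE e J : S e J = \sum_(l < J) z ^+ l * Qn l e f0.
  by rewrite /S seriesEord.
have t0 l e : 0 <= z ^+ l * Qn l e f0 by rewrite mulr_ge0 ?QEn_ge0 ?exprn_ge0 ?ltW.
have S_cvg e : cvgn (S e).
  have [C C0 QC] := decay e.
  apply: (@series_le_cvg _ _ (geometric C (z * d))) => //.
  - by move=> l; apply: mulr_ge0; [exact: ltW | apply: exprn_ge0; case/andP: zd].
  - move=> l /=; rewrite exprMn mulrCA ler_wpM2l ?exprn_ge0 ?(ltW z0) //.
  by apply: is_cvg_geometric_series; case/andP: zd => zd0 zd1; rewrite ger0_norm.
pose G e := limn (S e).
have S_le e J : S e J <= G e.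
  apply: nondecreasing_cvgn_le (S_cvg e) J.
  by apply: nondecreasing_series => l _ _; apply: t0.
have shift n e J : z ^+ n * \sum_(l < J) z ^+ l * Qn (n + l) e f0 <= G e.
  apply: le_trans (S_le e (n + J)%N).
  rewrite SE big_split_ord /= -[leLHS]add0r lerD ?sumr_ge0 //.
  by rewrite mulr_sumr; apply: ler_sum => l _; rewrite mulrA -exprD.
have shift1 e J (c : R) k : 0 <= c -> (forall l, c * Qn l (erev e) f0 <= Qn (k + l) e f0) ->
    c * S (erev e) J <= G e.
  move=> c0 cQ; apply: le_trans (shift k e J).
  rewrite SE mulr_sumr mulr_sumr; apply: ler_sum => l _.
  rewrite mulrCA mulrA -[leLHS]mul1r -mulrA ler_pM ?ler01 //.
  - by rewrite mulr_ge0 ?exprn_ge0 ?mulr_ge0 ?QEn_ge0 ?(ltW z0).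
  - by rewrite exprn_ege1 ?(ltW z1).
  by rewrite ler_wpM2l ?exprn_ge0 ?(ltW z0).
have G_erev e : mu^-1 ^+ K * G (erev e) <= G e.
  rewrite mulrC -ler_pdivlMr //; apply: limr_le; first exact: S_cvg.
  near=> J; rewrite ler_pdivlMr // mulrC; have [p [pp lp sp]] := revK e.
  apply: (shift1 _ _ _ (size p)); first exact: ltW.
  move=> l; apply: le_trans (QEn_comp1 R _ _ _ (erev e) _).
  rewrite ler_wpM2r ?QEn_ge0 // -lp; apply: le_trans (QEn_path R deg2 degM pp).
  by rewrite ler_wiXn2l ?invr_ge0 ?invf_le1 ?(ltW mu0).
have G_gt0 e : 0 < G e.
  have [m [p [pp lp _]]] := irr e f0.
  apply: lt_le_trans (S_le e (size p).+1).
  rewrite SE big_ord_recr /= -[ltLHS]add0r ler_ltD ?sumr_ge0 //.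
  rewrite mulr_gt0 ?exprn_gt0 // -lp.
  exact: lt_le_trans (QEn_path R deg2 degM pp).
have QG n (B : {fset edge X}) e :
    z ^+ n * \sum_(g <- B) Qn n e g * G g <= G e.
  have lim_sum : (fun J => z ^+ n * \sum_(g <- B) Qn n e g * S g J) @ \oo -->
      z ^+ n * \sum_(g <- B) Qn n e g * G g.
    apply: cvgMr; apply: (cvg_big (op := +%R) (P := xpredT)); first exact: add_continuous.
    by move=> g _; apply: cvgMr; apply: S_cvg.
  rewrite -(cvg_lim _ lim_sum) //; apply: limr_le; first by apply/cvg_ex; eexists; exact: lim_sum.
  near=> J; apply: le_trans (shift n e J).
  rewrite ler_wpM2l ?exprn_ge0 ?(ltW z0) //.
  under eq_bigr do rewrite SE mulr_sumr.
  rewrite exchange_big /=; apply: ler_sum => l _.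
  under eq_bigr do rewrite mulrCA.
  by rewrite -mulr_sumr ler_wpM2l ?exprn_ge0 ?(ltW z0) ?QEn_comp.
have [n zn] : exists n, z^-1 ^+ n < mu^-1 ^+ K / 2.
  have [||n nP] := @exprn_small R z^-1 (mu^-1 ^+ K / 2).
  - by rewrite invr_ge0 invf_lt1 ?ltW.
  - by rewrite divr_gt0.
  by exists n; apply: nP.
pose c := z^-1 ^+ n * mu ^+ K.
have c_lt : c < 2^-1.
  by rewrite /c -ltr_pdivlMr ?exprn_gt0 // mulrC -exprVn.
have [|F F0 AF] := @amenable_folner x (2 * n.+1%:R)^-1 am.
  by rewrite invr_gt0 mulr_gt0.
have schur := @schur_test R (edge X) (outs F) (fun e f => Qn n (erev e) f) G c.
have : \sum_(e <- outs F) \sum_(f <- outs F) Qn n (erev e) f <= c * (#|` outs F|)%:R.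
  apply: schur => //.
  - by move=> e f; apply: QEn_ge0.
  - by move=> e f; rewrite -[LHS]QEn_erev // erevK.
  move=> e; rewrite /c exprVn -mulrA.
  rewrite [leRHS]mulrC ler_pdivlMr ?exprn_gt0 // mulrC.
  apply: le_trans (QG _ _ _) _.
  by rewrite mulrC -ler_pdivrMr ?exprn_gt0 // mulrC -exprVn.
rewrite card_outs => /(le_trans (outs_mass n F)).
have V0 : (0 : R) < (Vol F)%:R by rewrite ltr0n Vol_gt0.
have : n.+1%:R * (Area F)%:R <= 2^-1 * (Vol F)%:R :> R.
  apply: le_trans (ler_wpM2l _ AF) _ => //.
  by rewrite mulrA invfM mulrCA mulfV ?mulr1 ?pnatr_eq0.
have : c * (Vol F)%:R < 2^-1 * (Vol F)%:R by rewrite ltr_pM2r.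
lra.
Unshelve. all: by end_near.
Qed.

End Amenable.

Section Nonamenable.
Variables (R : realType) (X : graph) (M : nat).
Hypothesis deg2 : forall x : X, (2 <= deg x)%N.
Hypothesis degM : forall x : X, (deg x <= M)%N.

Lemma rho_nonamenable (x y : X) : ~ amenable X R -> (rho R x y < 1%:E)%E.
Proof.
move=> nam; set i := iota_const X R.
have i0 : 0 < i by rewrite lt_neqAle eq_sym (iota_ge0 R x) andbT; apply/eqP.
have iso (F : {fset X}) : F != fset0 -> i * (Vol F)%:R <= (Area F)%:R.
  by move=> F0; rewrite -ler_pdivlMr ?iota_lbound // ltr0n Vol_gt0.
have M2 : (2 <= M)%N := leq_trans (deg2 x) (degM x).
have M1 : (0 < M.-1)%N by lia.
have decay := QEn_decay deg2 degM i0 iso _ _ _ M1.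
set k := gap M i in decay.
have k0 : 0 < k by rewrite /k /gap divr_gt0 ?mulr_gt0 ?exprn_gt0 ?ltr0n.
have z1 : 1 < 1 + k by rewrite ltrDl.
set z := 1 + k in decay z1.
pose w := (1 + z) / 2; have w1 : 1 < w by rewrite /w; lra.
have wz : w < z by rewrite /w; lra.
have [w0 z0] : 0 < w /\ 0 < z by lra.
pose B := M%:R * (k ^+ 2)^-1 * w.
have M0 : (0 : R) < M%:R by rewrite ltr0n (leq_trans _ M2).
have B0 : 0 < B by do 2! apply: mulr_gt0 => //; rewrite invr_gt0 exprn_gt0.
have [||N NP] := @exprn_small R (w / z) B^-1.
- by rewrite divr_ge0 ?ltW //= ltr_pdivrMr ?mul1r.
- by rewrite invr_gt0.
apply/(rho_lt1P _ _ _); exists w^-1; first by rewrite invr_gt0 w0 invf_lt1.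
exists N.+1 => -[//|n] Nn.
apply: le_trans (nbrw_le deg2 (B := (k ^+ 2)^-1 / z ^+ n) _ _ _) _.
  by move=> e f; rewrite ler_pdivlMr ?exprn_gt0 // mulrC.
apply: (@le_trans _ _ (M%:R * ((k ^+ 2)^-1 / z ^+ n))).
  by rewrite ler_wpM2r ?ler_nat // divr_ge0 ?invr_ge0 ?exprn_ge0 ?ltW.
have := NP _ Nn; rewrite -[X in _ < X]mul1r ltr_pdivlMr // /B => /ltW h.
rewrite exprVn -[leRHS]mul1r ler_pdivlMr ?exprn_gt0 //.
apply: le_trans h; rewrite [w ^+ n.+1]exprS [(w / z) ^+ n]expr_div_n.
move: (_^-1) (w ^+ n) (z ^+ n) => a b c.
by rewrite le_eqVlt; apply/orP; left; apply/eqP; ring.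
Qed.

End Nonamenable.

Theorem theorem1p7 (R : realType) (X : graph) (M : nat)
  (hconn : graph_connected X)
  (hcyc : small_cycles_dense X)
  (hdeg : forall x : X, (2 <= deg x)%N /\ (deg x <= M)%N)
  (x y : X) :
  amenable X R <-> rho R x y = 1%:E.
Proof.
have deg2 z := (hdeg z).1; have degM z := (hdeg z).2.
split=> [am|rho1]; last first.
  by apply: contrapT => /(rho_nonamenable deg2 degM x y); rewrite rho1 ltxx.
apply/eqP; rewrite eq_le rho_le1 //= leNgt; apply/negP.
have [[x0 dx0]|all2] := pselect (exists z : X, deg z <> 2%N).
  have [K revK] := uniform_reversal deg2 hconn hcyc (ex_intro _ x0 dx0).
  exact: rho_amenable deg2 M degM hconn K revK am x y.
apply: rho_regular2 => // z; apply: contrapT => dz; apply: all2; by exists z.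
Qed.
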